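(* Let $\mathcal{P} \subset \Delta(\mathcal{S})^{\mathcal{S}\times\mathcal{A}}$ be a nonempty compact (not necessarily convex) uncertainty set. The following three statements are equivalent. 1. ($\mathcal{P}$ is weakly s-tractable.) For all $\pi \in \Pi_{\mathsf S}$, all $r \in \mathbb{R}^{\mathcal{S}\times\mathcal{A}}$, all $\gamma \in [0,1)$ and all $\mu \in \Delta(\mathcal{S})$, $$\min_{P \in \mathcal{P}} \mu^\top v^{\pi,P} = \mu^\top u^{\pi}.$$ 2. For all $\pi \in \Pi_{\mathsf S}$, all $r \in \mathbb{R}^{\mathcal{S}\times\mathcal{A}}$ and all $\gamma \in [0,1)$, there exists $\hat P \in \mathcal{P}$ such that $u^{\pi} = v^{\pi,\hat P}$. 3. (Weak simultaneous solvability property.) For all $(\pi,V) \in \Pi_{\mathsf S}\times\mathbb{R}^{\mathcal{S}}$, $$\bigcap_{s \in \mathcal{S}} \arg\min_{P \in \mathcal{P}} \langle P_s, \pi_s V^\top\rangle \neq \emptyset .$$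
   Context: $\mathcal{S}$ (states) and $\mathcal{A}$ (actions) are finite nonempty sets; $\Delta(E)$ denotes the set of probability distributions on a finite set $E$. An uncertainty set is a subset $\mathcal{P} \subset \Delta(\mathcal{S})^{\mathcal{S}\times\mathcal{A}}$; its elements are written $P=(P_{sa})_{(s,a)}$ with $P_{sa}\in\Delta(\mathcal{S})\subset\mathbb{R}^{\mathcal{S}}$, and $P_s=(P_{sa})_{a\in\mathcal{A}}\in\mathbb{R}^{\mathcal{A}\times\mathcal{S}}$. Stationary policies: $\Pi_{\mathsf S}=\Delta(\mathcal{A})^{\mathcal{S}}$, $\pi=(\pi_s)_s$, $\pi_s=(\pi_{sa})_a\in\Delta(\mathcal{A})$. $\pi_sV^\top$ is the $\mathcal{A}\times\mathcal{S}$ matrix with entries $\pi_{sa}V_{s'}$, and $\langle A,B\rangle=\sum_{i,j}A_{ij}B_{ij}$, so that $\langle P_s,\pi_sV^\top\rangle=\sum_a\pi_{sa}P_{sa}^\top V$. Here rewards are independent of the next state: $r=(r_{sa})\in\mathbb{R}^{\mathcal{S}\times\mathcal{A}}$. For $\gamma\in[0,1)$, $\pi\in\Pi_{\mathsf S}$ and $P\in\mathcal{P}$, the value function $v^{\pi,P}\in\mathbb{R}^{\mathcal{S}}$ is $v^{\pi,P}_s=\mathbb{E}^{\pi,P}\big[\sum_{t\ge 0}\gamma^t r_{s_ta_t}\,\big|\,s_0=s\big]$ (with $0^0=1$), where $a_t\sim\pi_{s_t}$ and $s_{t+1}\sim P_{s_ta_t}$; equivalently it is the unique solution of $v_s=\sum_a\pi_{sa}(r_{sa}+\gamma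 P_{sa}^\top v)$ for all $s$. The vector $u^{\pi}\in\mathbb{R}^{\mathcal{S}}$ (depending on $\pi,r,\gamma,\mathcal{P}$) is the unique vector satisfying $u^\pi_s=\min_{P\in\mathcal{P}}\sum_{a\in\mathcal{A}}\pi_{sa}(r_{sa}+\gamma P_{sa}^\top u^\pi)$ for all $s\in\mathcal{S}$. *)

(* Defs.v *)
From HB Require Import structures.
From mathcomp Require Import all_boot all_order all_algebra.
From mathcomp Require Import all_classical all_reals all_analysis.
From mathcomp Require Import lra.

Set Implicit Arguments.
Unset Strict Implicit.
Unset Printing Implicit Defensive.

Import Order.TTheory GRing.Theory Num.Theory.
Import numFieldNormedType.Exports.

Local Open Scope classical_set_scope.
Local Open Scope ring_scope.

Section Optimisation.
Context {R : realType}.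

(* [minima X m] reads "min X exists and equals m". *)
Definition minima (X : set R) : set R := X `&` lbound X.

Definition argmin {T : Type} (D : set T) (f : T -> R) : set T :=
  [set x | D x /\ forall y, D y -> f x <= f y].

Definition simplex (E : finType) : set (E -> R) :=
  [set p | (forall e, 0 <= p e) /\ \sum_e p e = 1].

End Optimisation.

Section MDP.
Context {R : realType} {S A : finType}.

Definition policies : set (S -> A -> R) :=
  [set pi | forall s, simplex (pi s)].

Definition transitions : set (S -> A -> S -> R) :=
  [set P | forall s a, simplex (P s a)].

Section ValueFunction.
Variables (gamma : R) (r : S -> A -> R) (pi : S -> A -> R).
Variable P : S -> A -> S -> R.

(* A trajectory of length n is s_0, a_0, s_1, ..., a_(n-1), s_n; it is encoded
   by its states [x] and its actions [y]. Below, [widen_ord (leqnSn n) t] is t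
   and [lift ord0 t] is t + 1, as elements of 'I_n.+1. *)
Definition trajectory_prob (s : S) n (x : {ffun 'I_n.+1 -> S})
    (y : {ffun 'I_n -> A}) : R :=
  (x ord0 == s)%:R *
  \prod_(t < n) (pi (x (widen_ord (leqnSn n) t)) (y t) *
                 P (x (widen_ord (leqnSn n) t)) (y t) (x (lift ord0 t))).

Definition discounted_reward n (x : {ffun 'I_n.+1 -> S})
    (y : {ffun 'I_n -> A}) : R :=
  \sum_(t < n) gamma ^+ t * r (x (widen_ord (leqnSn n) t)) (y t).

Definition expected_reward n (s : S) : R :=
  \sum_(x : {ffun 'I_n.+1 -> S}) \sum_(y : {ffun 'I_n -> A})
    trajectory_prob s x y * discounted_reward x y.

(* The expectation of the infinite discounted sum, as the limit of the
   expectations of its partial sums (the terms are dominated by a geometric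
   series). [valueP] identifies it with the unique solution of the Bellman
   equation. *)
Definition value (s : S) : R := limn (expected_reward ^~ s).

Definition bellman (v : S -> R) (s : S) : R :=
  \sum_a pi s a * (r s a + gamma * \sum_s' P s a s' * v s').

End ValueFunction.

Definition robust_equation (U : set (S -> A -> S -> R)) (gamma : R)
    (r pi : S -> A -> R) (u : S -> R) : Prop :=
  forall s, minima [set bellman gamma r pi P u s | P in U] (u s).

(* The unique solution of [robust_equation]: see [robust_valueP]. *)
Definition robust_value (U : set (S -> A -> S -> R)) (gamma : R)
    (r pi : S -> A -> R) : S -> R :=
  xget (fun=> 0) [set u | robust_equation U gamma r pi u].

Definition frobenius (B C : A -> S -> R) : R :=
  \sum_a \sum_s B a s * C a s.

Definition outer (p : A -> R) (V : S -> R) : A -> S -> R :=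
  fun a s => p a * V s.

Definition weakly_s_tractable (U : set (S -> A -> S -> R)) : Prop :=
  forall (pi r : S -> A -> R) (gamma : R) (mu : S -> R),
    policies pi -> 0 <= gamma < 1 -> simplex mu ->
    minima [set \sum_s mu s * value gamma r pi P s | P in U]
      (\sum_s mu s * robust_value U gamma r pi s).

Definition robust_value_attained (U : set (S -> A -> S -> R)) : Prop :=
  forall (pi r : S -> A -> R) (gamma : R),
    policies pi -> 0 <= gamma < 1 ->
    exists2 P, U P & robust_value U gamma r pi = value gamma r pi P.

Definition weak_simultaneous_solvability (U : set (S -> A -> S -> R)) : Prop :=
  forall (pi : S -> A -> R) (V : S -> R), policies pi ->
    \bigcap_(s in [set: S])
      argmin U (fun P => frobenius (P s) (outer (pi s) V)) !=set0.

End MDP.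

Section Contraction.
Context {R : realType} {S : finType}.
Variables (gamma : R) (F : (S -> R) -> S -> R).
Hypothesis gamma_bounds : 0 <= gamma < 1.

Definition contraction : Prop := forall (v w : S -> R) (K : R),
  (forall s, `|v s - w s| <= K) -> forall s, `|F v s - F w s| <= gamma * K.

Hypothesis F_contraction : contraction.

Lemma contraction_unique v w : F v = v -> F w = w -> v = w.
Proof.
move=> Fv Fw; apply/funext => s.
have /andP[g0 g1] := gamma_bounds.
have [t _ tmax] := @arg_maxP _ R S s xpredT (fun s => `|v s - w s|) isT.
have := @F_contraction v w _ (fun i => tmax i isT) t; rewrite Fv Fw => le_t.
have t0 : `|v t - w t| <= 0.
  have := normr_ge0 (v t - w t); set x := `|_| in le_t * => x0; nra.
apply/eqP; rewrite -subr_eq0 -normr_le0; exact: le_trans (tmax s isT) t0.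
Qed.

Lemma contraction_limit (e : nat -> S -> R) : (forall n, e n.+1 = F (e n)) ->
  F (fun s => limn (e ^~ s)) = (fun s => limn (e ^~ s)).
Proof.
move=> eS; have /andP[g0 g1] := gamma_bounds.
pose K := \sum_s `|e 1%N s - e 0%N s|.
have de n s : `|e n.+1 s - e n s| <= K * gamma ^+ n.
  elim: n s => [|n IH] s.
    rewrite expr0 mulr1 /K (bigD1 s) //= lerDl; exact: sumr_ge0.
  have := @F_contraction (e n.+1) (e n) _ IH s; rewrite -!eS => h.
  by rewrite exprS mulrCA.
have ce s : cvgn (e ^~ s).
  have -> : (e ^~ s) = (fun n => e 0%N s + series (telescope (e ^~ s)) n).
    by apply/funext => n; rewrite -eq_sum_telescope.
  apply: is_cvgD; first exact: is_cvg_cst.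
  apply: normed_cvg; apply: (@series_le_cvg _ _ (geometric K gamma)).
  - by move=> n; exact: normr_ge0.
  - move=> n /=; rewrite mulr_ge0 ?exprn_ge0 //; exact: sumr_ge0.
  - by move=> n; exact: de.
  - by apply: is_cvg_geometric_series; rewrite ger0_norm.
set l := (fun s => _); apply/funext => s; apply/eqP.
rewrite -subr_eq0 -normr_le0; apply/ler_addgt0Pl => eps eps0; rewrite addr0.
have : \forall n \near \oo, forall t, `|l t - e n t| <= eps / 2.
  apply: filter_forall => t; have /cvgrPdist_le := ce t; apply.
  by rewrite divr_gt0.
move=> [N _ HN].
have H1 := HN N (leqnn _); have H2 := HN N.+1 (leqnSn _) s.
have := @F_contraction _ _ _ H1 s; rewrite -eS => H3.
have := ler_distD (e N.+1 s) (F l s) (l s); rewrite (distrC (e N.+1 s)) => H4.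
have : gamma * (eps / 2) <= eps / 2 by rewrite ger_pMl ?ltW // divr_gt0.
lra.
Qed.

End Contraction.

Section Simplex.
Context {R : realType} {E : finType}.

Lemma simplex_mean (p f g : E -> R) K : simplex p ->
  (forall x, `|f x - g x| <= K) ->
  `|\sum_x p x * f x - \sum_x p x * g x| <= K.
Proof.
move=> [p0 p1] fg; rewrite -sumrB -[K]mul1r -p1 mulr_suml.
apply: le_trans (ler_norm_sum _ _ _) _; apply: ler_sum => x _.
by rewrite -mulrBr normrM ger0_norm ?p0 // ler_wpM2l.
Qed.

End Simplex.

Lemma big_ffunS (R : realType) (T : finType) n (f : {ffun 'I_n.+1 -> T} -> R) :
  \sum_x f x = \sum_a \sum_(x : {ffun 'I_n -> T})
                 f [ffun i => oapp x a (unlift ord0 i)].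
Proof.
rewrite pair_big /= (reindex (fun p : T * {ffun 'I_n -> T} =>
  [ffun i => oapp p.2 p.1 (unlift ord0 i)])) //=.
exists (fun x => (x ord0, [ffun i => x (lift ord0 i)])) => [[a x] _|x _].
  congr pair; first by rewrite ffunE unlift_none.
  by apply/ffunP => i; rewrite !ffunE liftK.
by apply/ffunP => i; rewrite ffunE; case: unliftP => [j|] -> //=; rewrite ffunE.
Qed.

Lemma big_ffun0 (R : realType) (T : finType) (f : {ffun 'I_0 -> T} -> R) c :
  (forall x, f x = c) -> \sum_x f x = c.
Proof.
move=> fc; rewrite (eq_bigr (fun=> c)) // sumr_const.
by rewrite card_ffun card_ord expn0.
Qed.

Section Value.
Context {R : realType} {S A : finType}.
Variables (gamma : R) (r pi : S -> A -> R) (P : S -> A -> S -> R).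
Hypothesis gamma_bounds : 0 <= gamma < 1.
Hypothesis pi_policy : policies pi.
Hypothesis P_transition : transitions P.

Local Notation bell := (bellman gamma r pi P).

Lemma bellman_contraction : contraction gamma bell.
Proof.
have /andP[g0 g1] := gamma_bounds.
move=> v w K vw s; apply: simplex_mean; first exact: pi_policy.
move=> a; rewrite opprD addrACA subrr add0r -mulrBr normrM ger0_norm //.
by rewrite ler_wpM2l //; apply: simplex_mean; first exact: P_transition.
Qed.

Let cons n (T : finType) (a : T) (x : {ffun 'I_n -> T}) : {ffun 'I_n.+1 -> T} :=
  [ffun i => oapp x a (unlift ord0 i)].

Let cons0 n (T : finType) (a : T) (x : {ffun 'I_n -> T}) : cons a x ord0 = a.
Proof. by rewrite ffunE unlift_none. Qed.

Let consS n (T : finType) (a : T) (x : {ffun 'I_n -> T}) i :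
  cons a x (lift ord0 i) = x i.
Proof. by rewrite ffunE liftK. Qed.

Let widen0 n : widen_ord (leqnSn n.+1) ord0 = ord0.
Proof. exact: val_inj. Qed.

Let widenS n (t : 'I_n) :
  widen_ord (leqnSn n.+1) (lift ord0 t) = lift ord0 (widen_ord (leqnSn n) t).
Proof. exact: val_inj. Qed.

Lemma trajectory_probS n s s0 a
    (x : {ffun 'I_n.+1 -> S}) (y : {ffun 'I_n -> A}) :
  trajectory_prob pi P s (cons s0 x) (cons a y) =
  (s0 == s)%:R * (pi s0 a * P s0 a (x ord0) * trajectory_prob pi P (x ord0) x y).
Proof.
rewrite /trajectory_prob cons0 big_ord_recl widen0 !cons0 consS eqxx mul1r.
congr (_ * (_ * _)); apply: eq_bigr => t _.
by rewrite widenS !consS.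
Qed.

Lemma discounted_rewardS n s0 a
    (x : {ffun 'I_n.+1 -> S}) (y : {ffun 'I_n -> A}) :
  discounted_reward gamma r (cons s0 x) (cons a y) =
  r s0 a + gamma * discounted_reward gamma r x y.
Proof.
rewrite /discounted_reward big_ord_recl widen0 !cons0 expr0 mul1r.
congr (_ + _); rewrite mulr_sumr; apply: eq_bigr => t _.
by rewrite widenS !consS exprS mulrA.
Qed.

Lemma trajectory_sum n (f : S -> R)
    (g : {ffun 'I_n.+1 -> S} -> {ffun 'I_n -> A} -> R) :
  \sum_(x : {ffun 'I_n.+1 -> S}) \sum_(y : {ffun 'I_n -> A})
    f (x ord0) * trajectory_prob pi P (x ord0) x y * g x y =
  \sum_s f s * \sum_x \sum_y trajectory_prob pi P s x y * g x y.
Proof.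
under [RHS]eq_bigr => s _ do rewrite mulr_sumr.
rewrite [RHS]exchange_big /=; apply: eq_bigr => x _.
rewrite (bigD1 (x ord0)) //= mulr_sumr [X in _ = _ + X]big1 ?addr0.
  by apply: eq_bigr => y _; rewrite mulrA.
move=> s sx; rewrite big1 ?mulr0 // => y _.
by rewrite /trajectory_prob eq_sym (negbTE sx) !mul0r.
Qed.

Lemma trajectory_step n s
    (g : {ffun 'I_n.+2 -> S} -> {ffun 'I_n.+1 -> A} -> R) :
  \sum_x \sum_y trajectory_prob pi P s x y * g x y =
  \sum_a pi s a * \sum_s' P s a s' *
    \sum_x \sum_y trajectory_prob pi P s' x y * g (cons s x) (cons a y).
Proof.
rewrite big_ffunS (bigD1 s) //= [X in _ + X]big1 ?addr0; last first.
  move=> s0 s0s; rewrite big1 // => x _; rewrite big1 // => y _.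
  by rewrite /trajectory_prob -/(cons _ _) cons0 (negbTE s0s) !mul0r.
under eq_bigr => x _ do rewrite big_ffunS.
rewrite exchange_big; apply: eq_bigr => a _ /=.
rewrite -(@trajectory_sum n (P s a) (fun x y => g (cons s x) (cons a y))).
rewrite mulr_sumr; apply: eq_bigr => x _; rewrite mulr_sumr.
apply: eq_bigr => y _.
by rewrite -!/(cons _ _) trajectory_probS eqxx mul1r !mulrA.
Qed.

Lemma trajectory_prob1 n s :
  \sum_(x : {ffun 'I_n.+1 -> S}) \sum_(y : {ffun 'I_n -> A})
    trajectory_prob pi P s x y = 1.
Proof.
elim: n s => [|n IH] s.
  rewrite big_ffunS (bigD1 s) //= [X in _ + X]big1 ?addr0; last first.
    move=> s0 s0s; rewrite big1 // => x _; rewrite big1 // => y _.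
    by rewrite /trajectory_prob -/(cons _ _) cons0 (negbTE s0s) !mul0r.
  apply: big_ffun0 => x; apply: big_ffun0 => y.
  by rewrite /trajectory_prob -/(cons _ _) cons0 eqxx mul1r big_ord0.
under eq_bigr => x _ do under eq_bigr => y _ do
  rewrite -[trajectory_prob _ _ _ _ _]mulr1.
rewrite (@trajectory_step n s (fun _ _ => 1)).
transitivity (\sum_a pi s a); last by case: (pi_policy s).
apply: eq_bigr => a _.
rewrite -[RHS]mulr1; congr (_ * _).
transitivity (\sum_s' P s a s'); last by case: (P_transition s a).
apply: eq_bigr => s' _.
rewrite -[RHS]mulr1; congr (_ * _); rewrite -[RHS](IH s').
by apply: eq_bigr => x _; apply: eq_bigr => y _; rewrite mulr1.
Qed.

Lemma expected_rewardS n :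
  expected_reward gamma r pi P n.+1 = bell (expected_reward gamma r pi P n).
Proof.
apply/funext => s; rewrite /expected_reward trajectory_step.
apply: eq_bigr => a _; congr (_ * _).
have [_ P1] := P_transition s a.
rewrite -[X in X + _]mul1r -P1 mulr_suml mulr_sumr -big_split.
apply: eq_bigr => s' _ /=; rewrite mulrCA -mulrDr; congr (_ * _).
rewrite -[X in X + _]mulr1 -(trajectory_prob1 n s') !mulr_sumr -big_split.
apply: eq_bigr => x _ /=; rewrite !mulr_sumr -big_split.
apply: eq_bigr => y _ /=; rewrite discounted_rewardS mulrDr mulrC; congr (_ + _).
by rewrite mulrCA.
Qed.

Lemma valueP (v : S -> R) :
  v = value gamma r pi P <->
  forall s, v s = bellman gamma r pi P v s.
Proof.
have fixv : bell (value gamma r pi P) = value gamma r pi P.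
  apply: (contraction_limit gamma_bounds bellman_contraction).
  exact: expected_rewardS.
split=> [-> s|Ev]; first by rewrite -[LHS](congr1 (@^~ s) fixv).
apply: (contraction_unique gamma_bounds bellman_contraction) => //.
by apply/funext => s; exact: esym (Ev s).
Qed.

End Value.

Lemma continuous_sum (R : realType) (T : topologicalType) (I : finType)
    (g : I -> T -> R) :
  (forall i, continuous (g i)) -> continuous (fun x => \sum_i g i x).
Proof.
move=> cg; have Es : (fun x => \sum_i g i x) = \sum_i g i.
  by apply/funext => x; rewrite fct_sumE.
rewrite Es; elim/big_ind: _ => [|f h cf ch x|i _]; last exact: cg.
  by move=> x; exact: cvg_cst.
exact: cvgD (cf x) (ch x).
Qed.

Lemma continuous_bellman (R : realType) (S A : finType) (T : topologicalType)
    gamma (r pi : S -> A -> R) (p : T -> S -> A -> S -> R) u s :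
  (forall s a s', continuous (fun x => p x s a s')) ->
  continuous (fun x => bellman gamma r pi (p x) u s).
Proof.
move=> cp; apply: continuous_sum => a x.
apply: cvgM; first exact: cvg_cst.
apply: cvgD; first exact: cvg_cst.
apply: cvgM; first exact: cvg_cst.
apply: (@continuous_sum R T S (fun s' x => p x s a s' * u s')) => s' {}x.
by apply: cvgM; [exact: cp|exact: cvg_cst].
Qed.

Section Robust.
Context {R : realType} {S A : finType}.
Variables (U : set (S -> A -> S -> R)).
Hypothesis U_transitions : U `<=` transitions.
Hypothesis U_nonempty : U !=set0.
Hypothesis U_compact : compact (U : set {ptws S -> {ptws A -> {ptws S -> R}}}).
Variables (gamma : R) (r pi : S -> A -> R).
Hypothesis gamma_bounds : 0 <= gamma < 1.
Hypothesis pi_policy : policies pi.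

Let values u s := [set bellman gamma r pi P u s | P in U].

Lemma robust_bellman_min u s : exists m, minima (values u s) m.
Proof.
pose f (P : {ptws S -> {ptws A -> {ptws S -> R}}}) := bellman gamma r pi P u s.
have cf : continuous f.
  apply: (@continuous_bellman R S A {ptws S -> {ptws A -> {ptws S -> R}}}
            gamma r pi id) => t a t' P.
  have c1 := @proj_continuous S (fun=> {ptws A -> {ptws S -> R}}) t P.
  have c2 := @proj_continuous A (fun=> {ptws S -> R}) a (P t).
  have c3 := @proj_continuous S (fun=> R) t' (P t a).
  exact: (cvg_comp _ _ (cvg_comp _ _ c1 c2) c3).
have [P PU Pmin] := @compact_EVT_min {ptws S -> {ptws A -> {ptws S -> R}}}
  R f U U_nonempty U_compact (continuous_subspaceT cf).
exists (f P); split; first by exists P => //; rewrite -in_setE.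
by move=> _ [Q QU <-]; apply: Pmin; rewrite in_setE.
Qed.

Let F u s : R := xget 0 (minima (values u s)).

Let FP u s : minima (values u s) (F u s).
Proof. by have [m mP] := robust_bellman_min u s; apply: xgetPex; exists m. Qed.

Lemma robust_valueP (u : S -> R) :
  u = robust_value U gamma r pi <-> robust_equation U gamma r pi u.
Proof.
have F_contr : contraction gamma F.
  move=> v w K vw s.
  have [[P PU Pv] minv] := FP v s; have [[Q QU Qw] minw] := FP w s.
  have cP :=
    bellman_contraction r gamma_bounds pi_policy (U_transitions PU) vw s.
  have cQ :=
    bellman_contraction r gamma_bounds pi_policy (U_transitions QU) vw s.
  have lev : F v s <= bellman gamma r pi Q v s by apply: minv; exists Q.
  have lew : F w s <= bellman gamma r pi P w s by apply: minw; exists P.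
  move: cP cQ; rewrite !ler_norml -Pv -Qw => /andP[? ?] /andP[? ?].
  by apply/andP; split; lra.
have minima_unique (X : set R) a b : minima X a -> minima X b -> a = b.
  move=> [Xa la] [Xb lb]; apply/eqP.
  by rewrite eq_le la ?lb.
have eqF w : robust_equation U gamma r pi w <-> F w = w.
  split=> [wP|Fw s].
    by apply/funext => s; apply: minima_unique (FP w s) (wP s).
  by have := FP w s; rewrite Fw.
have ex : exists w, robust_equation U gamma r pi w.
  exists (fun s => limn ((fun n => iter n F (fun=> 0)) ^~ s)).
  by apply/eqF/(contraction_limit gamma_bounds F_contr).
have xP : robust_equation U gamma r pi (robust_value U gamma r pi).
  exact: (@xgetPex _ (fun=> 0) [set w | robust_equation U gamma r pi w]).
split=> [-> //|/eqF Fu].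
by apply: (contraction_unique gamma_bounds F_contr) => //; apply/eqF.
Qed.

End Robust.

(* Main.v *)
Require Import Defs.
From mathcomp Require Import all_boot all_order all_algebra.
From mathcomp Require Import all_classical all_reals all_analysis.
From mathcomp Require Import lra.

(** Write u for the robust value of a policy pi.  Since u solves the robust
    equation, u <= bellman P u for every P in U, and a subsolution of a
    monotone contraction lies below its fixed point: u <= v^P for all P in U
    ([robust_value_le]).  Everything follows from this inequality and from the
    splitting of the Bellman operator into an expected immediate reward, free
    of P, and gamma times the Frobenius product of the solvability property
    ([bellman_frobenius]).

    Tractability and attainment.  If u = v^P for some P in U, then P minimises
    mu^T v^Q over Q in U for every mu, by [robust_value_le].  Conversely, let P
    minimise for the uniform mu: then v^P - u is nonnegative and has average
    zero, so it vanishes.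

    Attainment and simultaneous solvability.  A kernel P satisfies u = v^P
    exactly when u is a fixed point of bellman P, that is, when P reaches the
    minimum of the robust equation at all states at once.  A common minimiser
    of the Frobenius products for V = u does so.  Conversely, every V is the
    robust value for a suitable state-dependent reward
    ([robust_value_prescribed]), and a kernel attaining that robust value is a
    common minimiser for V. *)

Set Implicit Arguments.
Unset Strict Implicit.
Unset Printing Implicit Defensive.

Import Order.TTheory GRing.Theory Num.Theory.
Import numFieldNormedType.Exports.

Local Open Scope classical_set_scope.
Local Open Scope ring_scope.

Lemma simplex_mean_le (R : realType) (E : finType) (p f g : E -> R) K :
  simplex p -> (forall x, f x - g x <= K) ->
  \sum_x p x * f x - \sum_x p x * g x <= K.
Proof.
move=> [p0 p1] fg; rewrite -sumrB -[K]mul1r -p1 mulr_suml.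
by apply: ler_sum => x _; rewrite -mulrBr ler_wpM2l.
Qed.

Lemma simplex_uniform (R : realType) (E : finType) :
  (0 < #|E|)%N -> simplex (fun=> #|E|%:R^-1 : R) (E := E).
Proof.
move=> E0; split=> [_|]; first by rewrite invr_ge0.
by rewrite sumr_const -[_ *+ _]mulr_natr mulVf // pnatr_eq0 -lt0n.
Qed.

Section Bellman.
Context {R : realType} {S A : finType}.
Variables (gamma : R) (r pi : S -> A -> R).

Lemma bellman_frobenius P v s :
  bellman gamma r pi P v s =
  \sum_a pi s a * r s a + gamma * frobenius (P s) (outer (pi s) v).
Proof.
rewrite /bellman /frobenius mulr_sumr -big_split; apply: eq_bigr => a _ /=.
rewrite mulrDr mulrCA; congr (_ + _ * _); rewrite mulr_sumr.
by apply: eq_bigr => s' _; rewrite mulrCA.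
Qed.

Hypothesis gamma_bounds : 0 <= gamma < 1.
Hypothesis pi_policy : policies pi.

Lemma bellman_sub_le P v w K : transitions P ->
  (forall s, v s - w s <= K) ->
  forall s, bellman gamma r pi P v s - bellman gamma r pi P w s <= gamma * K.
Proof.
have /andP[g0 _] := gamma_bounds.
move=> P_transition vw s; apply: simplex_mean_le => // a.
rewrite opprD addrACA subrr add0r -mulrBr ler_wpM2l //.
exact: simplex_mean_le.
Qed.

(** Comparison principle: at a state where [u - value] is largest, one Bellman
    step bounds that maximum by [gamma] times itself, so it is at most 0. *)
Lemma bellman_subsolution_le P u : transitions P ->
  (forall s, u s <= bellman gamma r pi P u s) ->
  forall s, u s <= value gamma r pi P s.
Proof.
move=> P_transition u_sub s; set v := value gamma r pi P.
have vE : forall t, v t = bellman gamma r pi P v t by apply/valueP.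
have [t _ tmax] := @arg_maxP _ R S s xpredT (fun t => u t - v t) isT.
have := bellman_sub_le P_transition (fun i => tmax i isT) t.
rewrite -vE => step; have := u_sub t; have := tmax s isT.
have /andP[_ g1] := gamma_bounds => /= max_s sub_t.
have : (1 - gamma) * (u t - v t) <= 0 by lra.
by rewrite pmulr_rle0 ?subr_gt0 // => ?; lra.
Qed.

End Bellman.

Section RobustValue.
Context {R : realType} {S A : finType}.
Variable U : set (S -> A -> S -> R).
Hypothesis U_transitions : U `<=` transitions.
Hypothesis U_nonempty : U !=set0.
Hypothesis U_compact : compact (U : set {ptws S -> {ptws A -> {ptws S -> R}}}).

Section Policy.
Variables (gamma : R) (pi : S -> A -> R).
Hypothesis gamma_bounds : 0 <= gamma < 1.
Hypothesis pi_policy : policies pi.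

Lemma robust_value_equation r :
  robust_equation U gamma r pi (robust_value U gamma r pi).
Proof. exact/robust_valueP. Qed.

Lemma robust_value_le_bellman r P s : U P ->
  robust_value U gamma r pi s <=
  bellman gamma r pi P (robust_value U gamma r pi) s.
Proof.
by move=> UP; have [_ lb] := robust_value_equation r s; apply: lb; exists P.
Qed.

Lemma robust_value_le r P s : U P ->
  robust_value U gamma r pi s <= value gamma r pi P s.
Proof.
move=> UP; apply: bellman_subsolution_le => //; first exact: U_transitions.
by move=> t; exact: robust_value_le_bellman.
Qed.

(** The reward at [s] is [V s] minus the minimum at [s] of the Bellman
    operators with zero reward.  It does not depend on the action, so a policy
    averages it to itself: it shifts all the Bellman values at [s] by the
    amount that makes their minimum equal to [V s]. *)
Lemma robust_value_prescribed (V : S -> R) :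
  exists r : S -> A -> R, robust_value U gamma r pi = V.
Proof.
have [m mP] := choice (robust_bellman_min U_nonempty U_compact
  gamma (fun _ _ => 0) pi V).
pose r := fun s (_ : A) => V s - m s; exists r.
have shift P s : bellman gamma r pi P V s =
    V s - m s + bellman gamma (fun _ _ => 0) pi P V s.
  have [_ pi1] := pi_policy s.
  rewrite !bellman_frobenius [in RHS]big1 => [|a _]; last by rewrite mulr0.
  by rewrite add0r -mulr_suml pi1 mul1r.
apply/esym/robust_valueP => // s; have [[P UP PE] lb] := mP s.
split; first by exists P => //; rewrite shift PE subrK.
move=> _ [Q UQ <-]; rewrite shift.
by have : m s <= bellman gamma (fun _ _ => 0) pi Q V s; [apply: lb; exists Q|lra].
Qed.

End Policy.

Lemma tractable_attained : (0 < #|S|)%N ->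
  weakly_s_tractable U -> robust_value_attained U.
Proof.
move=> S0 tractable pi r gamma pi_policy g01.
have [[P UP PE] _] := tractable pi r gamma _ pi_policy g01 (simplex_uniform R S0).
exists P => //; apply/funext => s; apply/eqP; rewrite eq_sym -subr_eq0.
have gap_ge0 t : 0 <= value gamma r pi P t - robust_value U gamma r pi t.
  by rewrite subr_ge0 robust_value_le.
have : \sum_t (value gamma r pi P t - robust_value U gamma r pi t) = 0.
  move/eqP: PE; rewrite -!mulr_sumr -subr_eq0 -mulrBr -sumrB mulf_eq0 invr_eq0.
  by rewrite pnatr_eq0 -leqn0 leqNgt S0 => /eqP.
by move=> /psumr_eq0P => ->.
Qed.

Lemma attained_tractable : robust_value_attained U -> weakly_s_tractable U.
Proof.
move=> attained pi r gamma mu pi_policy g01 [mu0 _].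
have [P UP uE] := attained pi r gamma pi_policy g01.
split; first by exists P => //; rewrite uE.
move=> _ [Q UQ <-]; apply: ler_sum => s _.
by rewrite ler_wpM2l // robust_value_le.
Qed.

Lemma attained_solvable :
  robust_value_attained U -> weak_simultaneous_solvability U.
Proof.
move=> attained pi V pi_policy.
(* Any discount factor in the open interval (0, 1) would do: it must be
   positive for the Bellman values to determine the Frobenius products. *)
have g01 : 0 <= (2^-1 : R) < 1 by apply/andP; split; lra.
have [r uV] := robust_value_prescribed g01 pi_policy V.
have [P UP uE] := attained pi r _ pi_policy g01; rewrite uV in uE.
have fixV s : V s = bellman 2^-1 r pi P V s.
  by move: s; apply/(valueP r g01 pi_policy (U_transitions UP)).
exists P => s _; split=> // Q UQ.
have := robust_value_le_bellman g01 pi_policy r s UQ.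
by rewrite uV [X in X <= _]fixV !bellman_frobenius lerD2l ler_pM2l.
Qed.

Lemma solvable_attained : (0 < #|S|)%N ->
  weak_simultaneous_solvability U -> robust_value_attained U.
Proof.
move=> /card_gt0P[s0 _] solvable pi r gamma pi_policy g01.
set u := robust_value U gamma r pi.
have [P Pmin] := solvable pi u pi_policy.
have UP : U P by have [] := Pmin s0 I.
exists P => //; apply/valueP => // [|s]; first exact: U_transitions.
apply/eqP; rewrite eq_le robust_value_le_bellman //=.
have [[Q UQ uE] _] := robust_value_equation g01 pi_policy r s.
have [_ /(_ Q UQ) PQ] := Pmin s I; have /andP[g0 _] := g01.
by rewrite [X in _ <= X]/u -uE -/u !bellman_frobenius lerD2l ler_wpM2l.
Qed.

End RobustValue.

Theorem theorem5 (R : realType) (S A : finType)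
    (S_nonempty : (0 < #|S|)%N) (A_nonempty : (0 < #|A|)%N)
    (U : set (S -> A -> S -> R))
    (U_transitions : U `<=` transitions)
    (U_nonempty : U !=set0)
    (U_compact : compact (U : set {ptws S -> {ptws A -> {ptws S -> R}}})) :
  (weakly_s_tractable U <-> robust_value_attained U) /\
  (robust_value_attained U <-> weak_simultaneous_solvability U).
Proof.
split; split.
- exact: tractable_attained.
- exact: attained_tractable.
- exact: attained_solvable.
- exact: solvable_attained.
Qed.
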